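(* For every $n\geq 1$, the diamond snake graph $D_n$ satisfies $$F_d(D_n)=\begin{cases}\frac{3n}{2} & \text{if } n \text{ is even},\\ \frac{3n+1}{2} & \text{if } n \text{ is odd}.\end{cases}$$
   Context: The diamond snake graph $D_n$ is the connected graph obtained from a path $P$ of length $n$ (that is, with $n$ edges) by replacing each edge $e=(u,v)$ of $P$ by a cycle of length $4$ in which $u$ and $v$ are nonadjacent vertices of the cycle. Explicitly, it has vertices $v_1,\dots,v_{n+1},u_1,\dots,u_n,w_1,\dots,w_n$, and for each $1\le i\le n$ both $u_i$ and $w_i$ are adjacent to exactly $v_i$ and $v_{i+1}$; there are no other edges. Zero forcing: given a set $B\subseteq V(G)$ of initially black vertices (all others white) of a finite simple graph $G$, at each step a black vertex having exactly one white neighbor forces that neighbor to become black; $B$ is a zero forcing set of $G$ if repeated application of this rule turns all vertices black. A set $D\subseteq V(G)$ is dominating if every vertex of $G$ is in $D$ or adjacent to a vertex of $D$. A dom-forcing set of $G$ is a set $D_f\subseteq V(G)$ that is both a dominating set of $G$ and a zero forcing set of $G$; the dom-forcing number $F_d(G)$ is the minimum cardinality of a dom-forcing set. *)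

(* Defs.v *)
From mathcomp Require Import all_boot.

Set Implicit Arguments.
Unset Strict Implicit.
Unset Printing Implicit Defensive.

Record sgraph := SGraph {
  vertex :> finType;
  adj : rel vertex;
  adj_sym : symmetric adj;
  adj_irrefl : irreflexive adj
}.

Section DomForcing.
Variable G : sgraph.
Implicit Types (B D : {set G}) (x y : G).

Definition neighbors x : {set G} := [set y | adj x y].

Definition dominating D : bool :=
  [forall x, (x \in D) || [exists y in D, adj x y]].

(* With B the set of black vertices, y is the only white neighbour of the
   black vertex x. *)
Definition forces B x y : bool :=
  (x \in B) && (neighbors x :\: B == [set y]).

Definition force_step : rel {set G} :=
  fun B B' => [exists x, exists y, forces B x y && (B' == y |: B)].

Definition zero_forcing B : bool := connect force_step B [set: G].

Definition dom_forcing D : bool := dominating D && zero_forcing D.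

(* The default [set: G] of the arg min is itself a dom-forcing set (see
   dom_forcingT), so this is the minimum cardinality of such a set. *)
Definition dom_forcing_number : nat :=
  #|[arg min_(D < [set: G] | dom_forcing D) #|D|]|.

Lemma dom_forcingT : dom_forcing [set: G].
Proof.
apply/andP; split; last exact: connect0.
by apply/forallP => x; rewrite inE.
Qed.

Lemma dom_forcing_number_attained :
  exists2 D, dom_forcing D & #|D| = dom_forcing_number.
Proof.
rewrite /dom_forcing_number; case: arg_minnP => [|D DF _].
  exact: dom_forcingT.
by exists D.
Qed.

Lemma dom_forcing_number_min D : dom_forcing D -> dom_forcing_number <= #|D|.
Proof.
rewrite /dom_forcing_number; case: arg_minnP => [|D0 _]; last exact.
exact: dom_forcingT.
Qed.

End DomForcing.

Section DiamondSnake.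
Variable n : nat.

(* Indices start at 0: inl i is v_(i+1), inr (inl i) is u_(i+1) and
   inr (inr i) is w_(i+1). *)
Definition diamond_vertex : finType := ('I_n.+1 + ('I_n + 'I_n))%type.

Definition incident (j : 'I_n.+1) (i : 'I_n) : bool :=
  (j == i :> nat) || (j == i.+1 :> nat).

Definition diamond_adj : rel diamond_vertex := fun x y =>
  match x, y with
  | inl j, inr (inl i) => incident j i
  | inl j, inr (inr i) => incident j i
  | inr (inl i), inl j => incident j i
  | inr (inr i), inl j => incident j i
  | _, _ => false
  end.

Lemma diamond_adj_sym : symmetric diamond_adj.
Proof. by move=> [j|[i|i]] [j'|[i'|i']]. Qed.

Lemma diamond_adj_irrefl : irreflexive diamond_adj.
Proof. by move=> [j|[i|i]]. Qed.

Definition diamond_snake : sgraph :=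
  SGraph diamond_adj_sym diamond_adj_irrefl.

End DiamondSnake.

(* Main.v *)
Require Import Defs.
From mathcomp Require Import all_boot.
From mathcomp Require Import zify.

(** Write [u], [w] for the two middle vertices of a diamond and [v], [v'] for
its ends.  Since [u] and [w] are twins, neither can be forced while both are
white, so a dom-forcing set [D] contains one of them; if it misses the other,
domination puts [v] or [v'] in [D].  Hence [c >= 1] and [c + [v] + [v'] >= 2]
in each diamond, where [c] counts the middle vertices in [D].  Summing both
inequalities over the [n] diamonds counts every vertex at most twice, so
[2 |D| >= 3 n].  Equality up to rounding is attained by all the [u_i] together
with every second [v_j]: [u_1] forces [v_1], then the forcing proceeds from
left to right. *)

Section ZeroForcing.
Variable G : sgraph.
Implicit Types (B D : {set G}) (x y z : G).

Definition force_closed B : Prop :=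
  forall x y, x \in B -> adj x y ->
    (forall z, adj x z -> z != y -> z \in B) -> y \in B.

(** Each force shrinks the white set, so forcing greedily ends in a set that admits no force. Such a
    set is closed, hence everything. This avoids listing a forcing sequence explicitly. *)
Lemma zero_forcing_closed B :
  (forall B', B \subset B' -> force_closed B' -> B' = setT) -> zero_forcing B.
Proof.
move=> clB; have [m] := ubnP #|~: B|.
elim: m B clB => // m IHm B clB leBm.
have [/existsP[x /existsP[y Fxy]]|noF] :=
  boolP [exists x, exists y, forces B x y].
  have /andP[xB /eqP Nx] := Fxy.
  have yB : y \notin B by have := set11 y; rewrite -Nx inE => /andP[].
  apply: (@connect_trans _ _ (y |: B)).
    apply: connect1; apply/existsP; exists x; apply/existsP; exists y.
    by rewrite Fxy eqxx.
  apply: IHm => [B' sB'|].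
    by apply: clB; apply: subset_trans sB'; apply: subsetUr.
  have := cardsC B; have := cardsC (y |: B); rewrite cardsU1 yB; lia.
suff -> : B = setT by apply: connect0.
apply: clB => // x y xB xy allB; apply: contraNT noF => yB.
apply/existsP; exists x; apply/existsP; exists y; rewrite /forces xB /=.
apply/eqP/setP => z; rewrite !inE.
have [->|zy] := eqVneq z y; first by rewrite yB.
by apply/negP => /andP[zB xz]; rewrite allB in zB.
Qed.

Lemma zero_forcing_twins B x y :
  x != y -> (forall z, adj z x = adj z y) -> zero_forcing B -> (x \in B) || (y \in B).
Proof.
move=> xNy twin /connectP[p pathp lastp].
(* Read backwards along the forcing sequence: a black twin at the end yields one at the start. *)
suff Inv q C : path (@force_step G) C q ->
    (x \in last C q) || (y \in last C q) -> (x \in C) || (y \in C).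
  by apply: Inv pathp _; rewrite -lastp inE.
elim: q C => //= C' q IHq C /andP[/existsP[z /existsP[t]]].
move=> /andP[/andP[_ /eqP Nz] /eqP defC'] /IHq{}IHq /IHq{IHq}.
rewrite defC' !inE; apply: contraLR; rewrite !negb_or => /andP[xC yC].
(* With both twins white, [z] sees both or neither, so its only white neighbour [t] is neither. *)
have [Nx Ny] : (x == t) = adj z y /\ (y == t) = adj z y.
  by split; [rewrite -twin|]; rewrite -in_set1 -Nz !inE ?xC ?yC.
apply/andP; split; rewrite ?xC ?yC andbT.
  by apply: contra xNy => xt; rewrite (eqP xt) eq_sym Ny -Nx.
by apply: contra xNy => yt; rewrite (eqP yt) Nx -Ny.
Qed.

End ZeroForcing.

Section Snake.
Variable n : nat.
Implicit Types (D : {set diamond_snake n}) (i : 'I_n) (j : 'I_n.+1).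

Local Notation V j := (inl j : diamond_snake n).
Local Notation U i := (inr (inl i) : diamond_snake n).
Local Notation W i := (inr (inr i) : diamond_snake n).

Definition lft i : 'I_n.+1 := widen_ord (leqnSn n) i.
Definition rgt i : 'I_n.+1 := lift ord0 i.

Lemma incidentE j i : incident j i = (j == lft i) || (j == rgt i).
Proof. by []. Qed.

Lemma card_diamond_set D :
  #|D| = \sum_j (V j \in D) + \sum_i ((U i \in D) + (W i \in D)).
Proof.
by rewrite -sum1_card big_mkcond /= big_sumType big_sumType big_split.
Qed.

Lemma dom_forcing_diamond D i : dom_forcing D ->
  let c := (U i \in D) + (W i \in D) in
  1 <= c /\ 2 <= c + (V (lft i) \in D) + (V (rgt i) \in D).
Proof.
move=> /andP[/forallP dom zf] /=.
have twin := @zero_forcing_twins _ D (U i) (W i) isT _ zf.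
have {twin} : (U i \in D) || (W i \in D) by apply: twin => -[j|[k|k]].
have endpoint x : x = U i \/ x = W i ->
    x \in D \/ (V (lft i) \in D) || (V (rgt i) \in D).
  move=> xi; case/orP: (dom x) => [|/exists_inP[y yD xy]]; [by left | right].
  case: y yD xy => [j|[k|k]] jD; case: xi => -> //=;
  by rewrite incidentE => /orP[] /eqP <-; rewrite jD ?orbT.
have [] := endpoint (U i); first by left.
all: have [] := endpoint (W i); first by right.
all: by do 4!case: (_ \in D).
Qed.

Lemma dom_forcing_lower D : dom_forcing D -> 3 * n <= 2 * #|D|.
Proof.
move=> DF.
pose c i := (U i \in D) + (W i \in D).
pose v j := nat_of_bool (V j \in D).
have cardD : #|D| = \sum_j v j + \sum_i c i := card_diamond_set D.
have h1 : n <= \sum_i c i.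
  rewrite -{1}(card_ord n) -sum1_card; apply: leq_sum => i _.
  by have [] := dom_forcing_diamond D i DF.
have h2 : n * 2 <= \sum_i c i + \sum_i v (lft i) + \sum_i v (rgt i).
  rewrite -!big_split /= -{1}(card_ord n) -sum_nat_const; apply: leq_sum => i _.
  by have [] := dom_forcing_diamond D i DF.
(* Left ends omit only the last [V], right ends only the first, so each sum in [h2] is at most the
   full one. *)
have hl : \sum_j v j = \sum_i v (lft i) + v ord_max by rewrite big_ord_recr.
have hr : \sum_j v j = v ord0 + \sum_i v (rgt i) by rewrite big_ord_recl.
lia.
Qed.

(* Indices start at 0, so the odd [j] are the paper's v_2, v_4, ... *)
Definition snake_set : {set diamond_snake n} :=
  [set x : diamond_snake n |
    match x with inl j => odd j | inr (inl _) => true | _ => false end].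

Lemma card_snake_set : #|snake_set| = n + n.+1./2.
Proof.
rewrite card_diamond_set addnC; congr (_ + _).
  rewrite -[RHS]card_ord -sum1_card; apply: eq_bigr => i _.
  by rewrite !inE.
under eq_bigr => j _ do rewrite inE.
elim: n.+1 => [|m IHm]; first by rewrite big_ord0.
by rewrite big_ord_recr /= IHm; lia.
Qed.

Lemma dominating_snake_set : 1 <= n -> dominating snake_set.
Proof.
move=> n_gt0; apply/forallP => -[j|[i|i]]; rewrite !inE //=.
- apply/orP; right; apply/exists_inP.
  (* For [j = 0] the truncated predecessor is [0], and the first [U] is still adjacent to [V j]. *)
  have lt_jn : j.-1 < n by have := ltn_ord j; lia.
  by exists (U (Ordinal lt_jn)); rewrite ?inE //= /incident /=; lia.
- apply/exists_inP; have [oi|ei] := boolP (odd i).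
  + by exists (V (lft i)); rewrite ?inE //= incidentE eqxx.
  + by exists (V (rgt i)); rewrite ?inE //= incidentE eqxx orbT.
Qed.

Lemma zero_forcing_snake_set : 1 <= n -> zero_forcing snake_set.
Proof.
move=> n_gt0; apply: zero_forcing_closed => B /subsetP sDB clB.
have UB i : U i \in B by apply: sDB; rewrite inE.
(* The other neighbour of the first [U] has odd index 1, hence is black. *)
have VB0 j : j = 0 :> nat -> V j \in B.
  move=> j0; apply: (clB (U (Ordinal n_gt0))) => //=.
    by rewrite /incident j0.
  case=> [k|[k|k]] //= kI kj; apply: sDB; rewrite inE.
  move: kI kj; rewrite /incident -[_ != _]/(k != j :> nat) /= j0.
  by case: (k : nat) => [|[]].
have WB j : V j \in B /\ forall i, i < j -> W i \in B.
  have [m] := ubnP (j : nat); elim: m j => // m IHm j le_jm.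
  have [j0|j_gt0] := posnP j.
    by split=> [|i]; [apply: VB0 | rewrite j0].
  have lt_jn : j.-1 < n by have := ltn_ord j; lia.
  pose k := Ordinal lt_jn.
  have [VkB WkB] : V (lft k) \in B /\ forall i, i < k -> W i \in B.
    by apply: (IHm (lft k)) => /=; lia.
  (* Apart from [W k], the neighbours of [V (lft k)] are [U]'s and possibly the preceding [W], all
     black. *)
  have WB : W k \in B.
    apply: (clB (V (lft k))) => //=; first by rewrite incidentE eqxx.
    case=> [l|[l|l]] //=; rewrite /incident /= => lI lk.
    apply: WkB; move: lI lk; rewrite -[_ != _]/(l != k :> nat) /=; lia.
  split=> [|i lt_ij].
    apply: (clB (W k)) => //=; first by rewrite /incident /=; lia.
    case=> [l|[l|l]] //=; rewrite incidentE => /orP[/eqP-> //|/eqP->].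
    have -> : rgt k = j by apply: val_inj; rewrite /= /bump /=; lia.
    by rewrite eqxx.
  have [eq_ik|ne_ik] := eqVneq (i : nat) k.
    by rewrite (val_inj eq_ik : i = k).
  by apply: WkB; move: ne_ik => /=; lia.
apply/setP => -[j|[i|i]]; rewrite inE ?UB //; first by case: (WB j).
by case: (WB (rgt i)) => _; apply; rewrite /= /bump /=; lia.
Qed.

End Snake.

Theorem theorem2p14 (n : nat) (hn : 1 <= n) :
  dom_forcing_number (diamond_snake n) =
    if odd n then (3 * n + 1) %/ 2 else (3 * n) %/ 2.
Proof.
have [D DF cardD] := dom_forcing_number_attained (diamond_snake n).
have lower := dom_forcing_lower n D DF; rewrite cardD in lower.
have DF' : dom_forcing (snake_set n).
  by rewrite /dom_forcing dominating_snake_set // zero_forcing_snake_set.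
have := dom_forcing_number_min DF'; rewrite card_snake_set.
(* [n + n.+1./2] is [3 * n / 2] rounded up, which meets [lower]. *)
by case: ifP; lia.
Qed.
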